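(* Let $n\in\mathbb Z$. The persistent homology functor $P_n:\mathcal F\to\mathcal P$ factors as $\mathcal F\to\operatorname{coim}P_n\xrightarrow{\Phi}\operatorname{im}P_n\hookrightarrow\mathcal P$, where $\mathcal F\to\operatorname{coim}P_n$ is the quotient functor and $\Phi$ is defined by $\Phi(X)=P_n(X)$ on objects and $\Phi([f])=P_n(f)$ on morphisms; and $\Phi$ is an equivalence of categories.
   Context: Fix a field $\mathbb F$; all vector spaces are finite-dimensional over $\mathbb F$. A complex is a family $(V_n,\partial_n)_{n\in\mathbb Z}$ with $\partial_n:V_n\to V_{n-1}$, $\partial_{n-1}\partial_n=0$, all but finitely many $\partial_n$ isomorphisms; morphisms are chain maps. A filtered complex is a family of complexes $({}_pV_\bullet)_{p\in\mathbb Z}$ with each ${}_pV_\bullet$ a subcomplex of ${}_{p+1}V_\bullet$, ${}_pV_\bullet=0$ for $p$ sufficiently small, and ${}_pV_\bullet={}_{p+1}V_\bullet$ for all but finitely many $p$; morphisms are families of chain maps commuting with the inclusions. $\mathcal F$ is the category of filtered complexes. A persistence vector space is a diagram $(W_p\to W_{p+1})_{p\in\mathbb Z}$ of vector spaces, morphisms being families of linear maps commuting with arrows; it is tempered if all but finitely many arrows are isomorphisms, and bounded below if $W_p=0$ for all sufficiently small $p$. $\mathcal P$ is the category of tempered persistence vector spaces and $\operatorname{im}P_n$ its full subcategory of those bounded below. $P_n$ sends a filtered complex to $(H_n({}_pV_\bullet)\to H_n({}_{p+1}V_\bullet))_p$ (maps induced by inclusions; $H_n$ is degree-$n$ homology)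 and acts on morphisms via $H_n$. The quotient category $\operatorname{coim}P_n$ has the same objects as $\mathcal F$, and its morphisms are equivalence classes $[f]$ of morphisms of $\mathcal F$ under the congruence $f\sim f'$ iff $P_n(f)=P_n(f')$. *)

(* Defs.v *)
From HB Require Import structures.
From mathcomp Require Import all_boot all_order all_algebra.
Set Implicit Arguments. Unset Strict Implicit. Unset Printing Implicit Defensive.
Import Order.TTheory GRing.Theory Num.Theory.
Local Open Scope ring_scope.

Definition lfun_iso (F : fieldType) (U V : vectType F) (f : 'Hom(U, V)) : Prop :=
  lker f = 0%VS /\ limg f = fullv.

Record complex (F : fieldType) := Complex {
  cobj : int -> vectType F;
  cd : forall n : int, 'Hom(cobj n, cobj (n - 1));
  cd_comp : forall n : int, (cd (n - 1) \o cd n)%VF = 0;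
  cd_fin : exists s : seq int, forall n : int, n \notin s -> lfun_iso (cd n)
}.

Record chain_map (F : fieldType) (C D : complex F) := ChainMap {
  cm : forall n : int, 'Hom(cobj C n, cobj D n);
  cm_comm : forall n : int, (cd D n \o cm n = cm (n - 1) \o cd C n)%VF
}.

(* _pV is a subcomplex of _{p+1}V: encoded by an injective chain map. *)
Record fcomplex (F : fieldType) := FComplex {
  fc : int -> complex F;
  fincl : forall p : int, chain_map (fc p) (fc (p + 1));
  fincl_inj : forall (p n : int), lker (cm (fincl p) n) = 0%VS;
  fc_low : exists p0 : int, forall p : int, p <= p0 ->
             forall n : int, \dim (fullv : {vspace cobj (fc p) n}) = 0%N;
  fc_fin : exists s : seq int, forall p : int, p \notin s ->
             forall n : int, limg (cm (fincl p) n) = fullv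
}.

Record fmor (F : fieldType) (X Y : fcomplex F) := FMor {
  fm : forall p : int, chain_map (fc X p) (fc Y p);
  fm_comm : forall (p n : int),
    (cm (fincl Y p) n \o cm (fm p) n = cm (fm (p + 1)) n \o cm (fincl X p) n)%VF
}.

Record pvs (F : fieldType) := PVS {
  pobj : int -> vectType F;
  parr : forall p : int, 'Hom(pobj p, pobj (p + 1))
}.

Definition tempered (F : fieldType) (W : pvs F) : Prop :=
  exists s : seq int, forall p : int, p \notin s -> lfun_iso (parr W p).

Definition bounded_below (F : fieldType) (W : pvs F) : Prop :=
  exists p0 : int, forall p : int, p <= p0 -> \dim (fullv : {vspace pobj W p}) = 0%N.

Record pmor (F : fieldType) (W W' : pvs F) := PMor {
  pm : forall p : int, 'Hom(pobj W p, pobj W' p);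
  pm_comm : forall p : int, (parr W' p \o pm p = pm (p + 1) \o parr W p)%VF
}.

Definition cycles (F : fieldType) (C : complex F) (n : int) : {vspace cobj C n} :=
  lker (cd C n).

Definition boundaries (F : fieldType) (C : complex F) (n : int) : {vspace cobj C n} :=
  eq_rect (n + 1 - 1) (fun k => {vspace cobj C k}) (limg (cd C (n + 1))) n (addrK 1 n).

(* H_n(C) := Z_n/B_n, realised as the complement Z_n :\: B_n of B_n in Z_n
   (canonically isomorphic to the quotient, with the quotient map given by the
   projection addv_pi1 Z_n B_n of Z_n onto it along B_n). *)
Definition homology (F : fieldType) (C : complex F) (n : int) : vectType F :=
  subvs_of (cycles C n :\: boundaries C n)%VS.

Definition hmap (F : fieldType) (C D : complex F) (f : chain_map C D) (n : int)
  : 'Hom(homology C n, homology D n) :=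
  (linfun (vsproj (cycles D n :\: boundaries D n)%VS)
    \o addv_pi1 (cycles D n) (boundaries D n)
    \o cm f n
    \o linfun (@vsval _ _ (cycles C n :\: boundaries C n)%VS))%VF.

Definition Pn (F : fieldType) (n : int) (X : fcomplex F) : pvs F :=
  @PVS F (fun p => homology (fc X p) n) (fun p => hmap (fincl X p) n).

Definition Pn_mor (F : fieldType) (n : int) (X Y : fcomplex F) (f : fmor X Y)
  (p : int) : 'Hom(pobj (Pn n X) p, pobj (Pn n Y) p) :=
  hmap (fm f p) n.

Definition coim_eq (F : fieldType) (n : int) (X Y : fcomplex F) (f f' : fmor X Y) : Prop :=
  forall p : int, Pn_mor n f p = Pn_mor n f' p.

(* Phi is a well-defined functor into im P_n (so that P_n = incl o Phi o quotient). *)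
Definition Phi_functor (F : fieldType) (n : int) : Prop :=
  (forall X : fcomplex F, tempered (Pn n X) /\ bounded_below (Pn n X)) /\
  (forall (X Y : fcomplex F) (f f' : fmor X Y), coim_eq n f f' ->
     forall p, Pn_mor n f p = Pn_mor n f' p) /\
  (forall (X Y : fcomplex F) (f : fmor X Y) (p : int),
     (parr (Pn n Y) p \o Pn_mor n f p = Pn_mor n f (p + 1) \o parr (Pn n X) p)%VF) /\
  (forall (X : fcomplex F) (e : fmor X X),
     (forall p k, cm (fm e p) k = \1%VF) -> forall p, Pn_mor n e p = \1%VF) /\
  (forall (X Y Z : fcomplex F) (f : fmor X Y) (g : fmor Y Z) (h : fmor X Z),
     (forall p k, cm (fm h p) k = (cm (fm g p) k \o cm (fm f p) k)%VF) ->
     forall p, Pn_mor n h p = (Pn_mor n g p \o Pn_mor n f p)%VF).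

Definition Phi_faithful (F : fieldType) (n : int) : Prop :=
  forall (X Y : fcomplex F) (f f' : fmor X Y),
    (forall p, Pn_mor n f p = Pn_mor n f' p) -> coim_eq n f f'.

Definition Phi_full (F : fieldType) (n : int) : Prop :=
  forall (X Y : fcomplex F) (g : pmor (Pn n X) (Pn n Y)),
    exists f : fmor X Y, forall p, Pn_mor n f p = pm g p.

Definition pvs_iso (F : fieldType) (W W' : pvs F) : Prop :=
  exists (a : pmor W W') (b : pmor W' W),
    forall p, (pm b p \o pm a p = \1)%VF /\ (pm a p \o pm b p = \1)%VF.

Definition Phi_ess_surj (F : fieldType) (n : int) : Prop :=
  forall W : pvs F, tempered W -> bounded_below W ->
    exists X : fcomplex F, pvs_iso (Pn n X) W.

Definition Phi_equivalence (F : fieldType) (n : int) : Prop :=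
  Phi_faithful F n /\ Phi_full F n /\ Phi_ess_surj F n.

(* Main.v *)
Require Import Defs.
From HB Require Import structures.
From mathcomp Require Import all_boot all_order all_algebra.
From mathcomp Require Import zify.
Set Implicit Arguments. Unset Strict Implicit. Unset Printing Implicit Defensive.
Import Order.TTheory GRing.Theory Num.Theory.
Local Open Scope ring_scope.

(** Fullness: a morphism [g : P_n X -> P_n Y] is lifted by a filtered chain map
    supported in degrees [n] and [n + 1], built by recursion on the filtration
    degree [p] from the first index where [X] is nonzero.  In degree [n] it takes
    values in cycles and induces [g]; in degree [n + 1] it vanishes on cycles.
    Both recursion steps extend a map from [pX] to [(p+1)X], correcting a map that
    satisfies the constraints but does not extend the given one, by means of a
    retraction [(p+1)X -> pX] that preserves cycles.

    Essential surjectivity: [W] is covered by surjections [E_p -> W_p] along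
    injections [E_p -> E_(p+1)], where [E_(p+1) = E_p] whenever [W_p -> W_(p+1)] is
    an isomorphism; the filtered complex is [ker (E_p -> W_p) -> E_p] placed in
    degrees [n + 1] and [n]. *)

(* Going through whole families updated at one index at a time avoids casting along
   equations between integers. *)
Definition int_rec (T : int -> Type) (p0 : int) (t0 : forall p, T p)
    (S : forall p, T p -> T (p + 1)) : nat -> forall p, T p :=
  fix t k := if k is k'.+1 then dfwith (t k') (S (p0 + k'%:Z) (t k' (p0 + k'%:Z)))
             else t0.

(** Passing to stage [k + 1] of [int_rec] changes only the entry at [p0 + k + 1]. Hence the diagonal
    family, which reads the entry at [p] off stage [|p - p0|], satisfies the recursion and is
    untouched up to [p0]. *)
Lemma exists_int_rec (T : int -> Type) (p0 : int) (t0 : forall p, T p)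
    (S : forall p, T p -> T (p + 1)) :
  {t : forall p, T p | (forall p : int, p <= p0 -> t p = t0 p) /\
                       (forall p : int, p0 <= p -> t (p + 1) = S p (t p))}.
Proof.
have recS k (p : int) : p != p0 + k%:Z + 1 ->
    int_rec p0 t0 S k.+1 p = int_rec p0 t0 S k p.
  by move=> neq_p; rewrite /= dfwith_out // eq_sym.
have rec_low k (p : int) : p <= p0 -> int_rec p0 t0 S k p = t0 p.
  by move=> le_p; elim: k => // k IHk; rewrite recS //; lia.
exists (fun p : int => int_rec p0 t0 S `|p - p0|%N p); split=> p le_p; first exact: rec_low.
have [k ->] : exists k : nat, p = p0 + k%:Z by exists `|p - p0|%N; lia.
have -> : `|(p0 + k%:Z)%R - p0|%N = k by lia.
have -> : `|(p0 + k%:Z + 1)%R - p0|%N = k.+1 by lia.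
by rewrite /= dfwith_in.
Qed.

(** * Linear algebra: retractions and extension of maps along an injection *)

Section LinearMaps.
Variable F : fieldType.
Implicit Types U V W Y : vectType F.

Lemma dim0_eq0 V (v : V) : \dim (fullv : {vspace V}) = 0%N -> v = 0.
Proof.
by move/eqP; rewrite dimv_eq0 => /eqP V0; apply/eqP; rewrite -memv0 -V0 memvf.
Qed.

Lemma dim0_hom_eq U V (f g : 'Hom(U, V)) :
  \dim (fullv : {vspace U}) = 0%N -> f = g.
Proof. by move=> U0; apply/lfunP=> u; rewrite (dim0_eq0 u U0) !linear0. Qed.

Lemma lker0_eq0 U V (f : 'Hom(U, V)) u : lker f = 0%VS -> f u = 0 -> u = 0.
Proof. by move=> kf fu; apply/eqP; rewrite -memv0 -kf memv_ker fu. Qed.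

Lemma lfun_isoP U V (f : 'Hom(U, V)) :
  lfun_iso f <-> (forall u, f u = 0 -> u = 0) /\ (forall v, exists u, v = f u).
Proof.
split=> [[kf rf] | [kf rf]]; split.
- by move=> u; apply: lker0_eq0.
- move=> v; have: v \in limg f by rewrite rf memvf.
  by case/memv_imgP=> u _; exists u.
- apply/eqP; rewrite -subv0; apply/subvP=> u.
  by rewrite memv_ker memv0 => /eqP/kf->.
- apply/eqP; rewrite eqEsubv subvf; apply/subvP=> v _.
  by have [u ->] := rf v; rewrite memv_img ?memvf.
Qed.

(* A retraction of [i] mapping [ker D] to [ker (D \o i)]: the retraction [i^-1] followed
   by the projection [1 - m^-1 m] onto [ker m], corrected by a term factoring through [D]. *)
Definition strict_retr U V W (i : 'Hom(U, V)) (D : 'Hom(V, W)) : 'Hom(V, U) :=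
  let m := (D \o i)%VF in
  (((\1 - (m^-1 \o m)%VF) \o i^-1)%VF + (m^-1 \o D)%VF).

Lemma strict_retrE U V W (i : 'Hom(U, V)) (D : 'Hom(V, W)) v :
  let m := (D \o i)%VF in
  strict_retr i D v = i^-1%VF v - m^-1%VF (m (i^-1%VF v)) + m^-1%VF (D v).
Proof.
by rewrite /strict_retr add_lfunE !comp_lfunE add_lfunE opp_lfunE id_lfunE !comp_lfunE.
Qed.

Lemma strict_retrK U V W (i : 'Hom(U, V)) (D : 'Hom(V, W)) :
  lker i = 0%VS -> cancel i (strict_retr i D).
Proof.
by move=> ki u; rewrite strict_retrE lker0_lfunK ?ki // comp_lfunE subrK.
Qed.

Lemma strict_retr_ker U V W (i : 'Hom(U, V)) (D : 'Hom(V, W)) v :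
  D v = 0 -> D (i (strict_retr i D v)) = 0.
Proof.
move=> Dv; rewrite strict_retrE Dv linear0 addr0 -(comp_lfunE D i) linearB /=.
by rewrite limg_lfunVK ?subrr // memv_img ?memvf.
Qed.

(** Adds to [phi] its defect [h - phi \o i], carried to [V] by the retraction. As the retraction
    sends [ker D] into [ker (D \o i)], conditions imposed on [ker D] survive whenever the defect
    respects them. *)
Definition ext_along U V W Y (i : 'Hom(U, V)) (D : 'Hom(V, W))
    (h : 'Hom(U, Y)) (phi : 'Hom(V, Y)) : 'Hom(V, Y) :=
  phi + ((h - (phi \o i)%VF) \o strict_retr i D)%VF.

Lemma ext_alongE U V W Y (i : 'Hom(U, V)) (D : 'Hom(V, W))
    (h : 'Hom(U, Y)) (phi : 'Hom(V, Y)) v :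
  ext_along i D h phi v =
    phi v + (h (strict_retr i D v) - phi (i (strict_retr i D v))).
Proof. by rewrite /ext_along add_lfunE comp_lfunE add_lfunE opp_lfunE comp_lfunE. Qed.

Lemma ext_along_ext U V W Y (i : 'Hom(U, V)) (D : 'Hom(V, W))
    (h : 'Hom(U, Y)) (phi : 'Hom(V, Y)) u :
  lker i = 0%VS -> ext_along i D h phi (i u) = h u.
Proof. by move=> ki; rewrite ext_alongE strict_retrK // addrC subrK. Qed.

End LinearMaps.

(** * Homology classes, representatives and induced maps *)

Section Homology.
Variable F : fieldType.
Implicit Types C D : complex F.

(** On cycles this is the quotient map onto homology; off cycles it is merely some linear
    extension. *)
Definition hclass C n : 'Hom(cobj C n, homology C n) :=
  (linfun (vsproj (cycles C n :\: boundaries C n)%VS)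
    \o addv_pi1 (cycles C n) (boundaries C n))%VF.

Definition hrepr C n : 'Hom(homology C n, cobj C n) :=
  linfun (@vsval _ _ (cycles C n :\: boundaries C n)%VS).

(* Working in degree [m - 1] makes the transport in [boundaries] trivial. *)
Lemma boundariesE C m : boundaries C (m - 1) = limg (cd C m).
Proof.
rewrite /boundaries; set e := addrK _ _; move: e.
rewrite subrK => e; by rewrite (eq_irrelevance e erefl).
Qed.

Lemma cyclesE C n (z : cobj C n) : (z \in cycles C n) = (cd C n z == 0).
Proof. by rewrite memv_ker. Qed.

Lemma cdd C n (z : cobj C n) : cd C (n - 1) (cd C n z) = 0.
Proof. by rewrite -comp_lfunE cd_comp lfunE. Qed.

Lemma boundaries_sub C n : (boundaries C n <= cycles C n)%VS.
Proof.
rewrite -[n](addrK 1 n) boundariesE; apply/subvP=> _ /memv_imgP[w _ ->].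
by rewrite cyclesE cdd.
Qed.

Lemma hreprK C n : cancel (hrepr C n) (hclass C n).
Proof.
move=> x; rewrite /hclass /hrepr !lfunE /= !lfunE /=.
by rewrite daddv_pi_id ?capv_diff ?subvsP // vsvalK.
Qed.

Lemma hrepr_cycle C n x : hrepr C n x \in cycles C n.
Proof. by rewrite lfunE /= (subvP (diffvSl _ _) _ (subvsP x)). Qed.

Lemma hrepr_class C n z :
  z \in cycles C n -> z - hrepr C n (hclass C n z) \in boundaries C n.
Proof.
move=> Zz; rewrite /hclass /hrepr !lfunE /= !lfunE /= vsprojK ?memv_pi //.
have Zz' : z \in (cycles C n + boundaries C n)%VS by rewrite (subvP (addvSl _ _)).
by rewrite -{1}(addv_pi1_pi2 Zz') addrC addKr memv_pi2.
Qed.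

(** The representative of the class of [b] differs from [b] by a boundary, so it is itself a
    boundary; it also lies in the chosen complement of the boundaries, hence is zero. *)
Lemma hclass_boundary C n b : b \in boundaries C n -> hclass C n b = 0.
Proof.
move=> Bb; have Zb := subvP (boundaries_sub C n) _ Bb.
have B' : hrepr C n (hclass C n b) \in boundaries C n.
  by rewrite -[hrepr _ _ _](subKr b) rpredB // hrepr_class.
have h0 : hrepr C n (hclass C n b) = 0.
  apply/eqP; rewrite -memv0 -(capv_diff (cycles C n) (boundaries C n)).
  by rewrite memv_cap B' andbT lfunE /= subvsP.
by rewrite -[LHS]hreprK h0 linear0.
Qed.

Lemma hclass_eq0 C n z : z \in cycles C n -> hclass C n z = 0 -> z \in boundaries C n.
Proof.
by move=> Zz h0; have := hrepr_class Zz; rewrite h0 linear0 subr0.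
Qed.

Lemma hclass_surj C n (x : homology C n) :
  exists2 z, z \in cycles C n & x = hclass C n z.
Proof. by exists (hrepr C n x); rewrite ?hrepr_cycle ?hreprK. Qed.

Lemma cm_cd C D (f : chain_map C D) n x : cd D n (cm f n x) = cm f (n - 1) (cd C n x).
Proof. by rewrite -!comp_lfunE cm_comm. Qed.

Lemma cm_cycle C D (f : chain_map C D) n z :
  z \in cycles C n -> cm f n z \in cycles D n.
Proof. by rewrite !cyclesE cm_cd => /eqP->; rewrite linear0. Qed.

Lemma cm_boundary C D (f : chain_map C D) n z :
  z \in boundaries C n -> cm f n z \in boundaries D n.
Proof.
move: z; rewrite -[n](addrK 1 n) !boundariesE => _ /memv_imgP[w _ ->].
by rewrite -cm_cd memv_img ?memvf.
Qed.

Lemma hmapE C D (f : chain_map C D) n x :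
  hmap f n x = hclass D n (cm f n (hrepr C n x)).
Proof. by rewrite /hmap /hclass !comp_lfunE. Qed.

Lemma hmap_class C D (f : chain_map C D) n z :
  z \in cycles C n -> hmap f n (hclass C n z) = hclass D n (cm f n z).
Proof.
move=> Zz; rewrite hmapE; apply/eqP; rewrite eq_sym -subr_eq0 -linearB -linearB.
exact/eqP/hclass_boundary/cm_boundary/hrepr_class.
Qed.

Lemma hmap_compE C D E (f : chain_map C D) (g : chain_map D E) n z :
  z \in cycles C n ->
  (hmap g n \o hmap f n)%VF (hclass C n z) = hclass E n ((cm g n \o cm f n)%VF z).
Proof.
move=> Zz; rewrite (comp_lfunE (hmap g n)) (comp_lfunE (cm g n)).
by rewrite !hmap_class ?cm_cycle.
Qed.

Lemma hmap_comp C D E (f : chain_map C D) (g : chain_map D E) (h : chain_map C E) n :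
  cm h n = (cm g n \o cm f n)%VF -> hmap h n = (hmap g n \o hmap f n)%VF.
Proof.
move=> hE; apply/lfunP=> x; have [z Zz ->] := hclass_surj x.
by rewrite hmap_compE // hmap_class // hE.
Qed.

Lemma hmap_square C D D' E (f : chain_map C D) (g : chain_map D E)
    (f' : chain_map C D') (g' : chain_map D' E) n :
  (cm g n \o cm f n = cm g' n \o cm f' n)%VF ->
  (hmap g n \o hmap f n = hmap g' n \o hmap f' n)%VF.
Proof.
move=> eq_gf; apply/lfunP=> x; have [z Zz ->] := hclass_surj x.
by rewrite !hmap_compE // eq_gf.
Qed.

Lemma hmap_id C (f : chain_map C C) n : cm f n = \1%VF -> hmap f n = \1%VF.
Proof. by move=> f1; apply/lfunP=> x; rewrite hmapE f1 !id_lfunE hreprK. Qed.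

(** Neighbouring degrees enter: surjectivity one degree up lifts bounding chains, and injectivity
    one degree down makes preimages of cycles cycles. *)
Lemma hmap_iso C D (f : chain_map C D) :
  (forall n, lfun_iso (cm f n)) -> forall n, lfun_iso (hmap f n).
Proof.
move=> f_iso n; have kf k := (proj1 (lfun_isoP _) (f_iso k)).1.
have rf k := (proj1 (lfun_isoP _) (f_iso k)).2.
rewrite -[n](addrK 1 n); move: (n + 1) => m {n}; apply/lfun_isoP; split=> [x | y].
  have [z Zz ->] := hclass_surj x; rewrite hmap_class // => /hclass_eq0-/(_ (cm_cycle _ Zz)).
  rewrite boundariesE => /memv_imgP[y _]; have [w ->] := rf _ y.
  rewrite cm_cd => /eqP; rewrite -subr_eq0 -linearB => /eqP/kf/eqP.
  by rewrite subr_eq0 => /eqP->; rewrite hclass_boundary // boundariesE memv_img ?memvf.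
have [z Zz ->] := hclass_surj y; have [w z_fw] := rf _ z.
have Zw : w \in cycles C (m - 1).
  by rewrite cyclesE; apply/eqP/kf/eqP; rewrite -cm_cd -z_fw -cyclesE.
by exists (hclass C (m - 1) w); rewrite hmap_class // z_fw.
Qed.

End Homology.

Lemma Phi_is_functor (F : fieldType) (n : int) : Phi_functor F n.
Proof.
split; [|split=> //; split; [|split]].
- move=> X; split.
    have [s sP] := fc_fin X; exists s => p sp; apply: hmap_iso => k.
    by split; [apply: fincl_inj | apply: sP].
  have [p0 p0P] := fc_low X; exists p0 => p le_p.
  apply/eqP; rewrite dimv_eq0 -subv0; apply/subvP=> x _; rewrite memv0.
  by rewrite -[x]hreprK (dim0_eq0 (hrepr _ _ _) (p0P _ le_p _)) linear0.
- by move=> X Y f p; apply/hmap_square/fm_comm.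
- by move=> X e e1 p; apply: hmap_id.
- by move=> X Y Z f g h hE p; apply: hmap_comp.
Qed.

(** * Chain maps supported in two adjacent degrees *)

Section TwoDegrees.
Variable F : fieldType.

Definition two_deg (A B : int -> vectType F) m (a : 'Hom(A (m - 1), B (m - 1)))
    (b : 'Hom(A m, B m)) : forall k, 'Hom(A k, B k) :=
  dfwith (dfwith (fun k => 0 : 'Hom(A k, B k)) a) b.

Section TwoDegTheory.
Variables (A B : int -> vectType F) (m : int).
Variables (a : 'Hom(A (m - 1), B (m - 1))) (b : 'Hom(A m, B m)).

Lemma two_deg_top : two_deg a b m = b.
Proof. by rewrite /two_deg dfwith_in. Qed.

Lemma two_deg_bot : two_deg a b (m - 1) = a.
Proof. by rewrite /two_deg dfwith_out ?dfwith_in //; lia. Qed.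

Lemma two_deg_out k : k != m -> k != m - 1 -> two_deg a b k = 0.
Proof. by move=> km km1; rewrite /two_deg !dfwith_out // eq_sym. Qed.

End TwoDegTheory.

Lemma two_deg_natural (A B A' B' : int -> vectType F) m
    (a : 'Hom(A (m - 1), B (m - 1))) (b : 'Hom(A m, B m))
    (a' : 'Hom(A' (m - 1), B' (m - 1))) (b' : 'Hom(A' m, B' m))
    (i : forall k, 'Hom(A k, A' k)) (j : forall k, 'Hom(B k, B' k)) :
  (j (m - 1) \o a = a' \o i (m - 1))%VF -> (j m \o b = b' \o i m)%VF ->
  forall k, (j k \o two_deg a b k = two_deg a' b' k \o i k)%VF.
Proof.
move=> ja jb k; have [-> | km] := eqVneq k m; first by rewrite !two_deg_top.
have [-> | km1] := eqVneq k (m - 1); first by rewrite !two_deg_bot.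
by rewrite !two_deg_out // comp_lfun0l comp_lfun0r.
Qed.

Variables (C D : complex F) (m : int).
Variables (a : 'Hom(cobj C (m - 1), cobj D (m - 1))) (b : 'Hom(cobj C m, cobj D m)).
Hypothesis da : (cd D (m - 1) \o a)%VF = 0.
Hypothesis db : (cd D m \o b = a \o cd C m)%VF.
Hypothesis bZ : (cycles C m <= lker b)%VS.

Lemma two_deg_comm k :
  (cd D k \o two_deg a b k = two_deg a b (k - 1) \o cd C k)%VF.
Proof.
have [-> | km] := eqVneq k m; first by rewrite two_deg_top two_deg_bot.
have [-> | km1] := eqVneq k (m - 1).
  rewrite two_deg_bot da two_deg_out ?comp_lfun0l //; lia.
(* In degree [m + 1] the identity holds because [b] kills cycles, hence boundaries. The type of
   [cd C k] blocks rewriting with [k - 1 = m], so only the vanishing on cycles is transferred, to an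
   abstract [b0]. *)
rewrite (two_deg_out _ _ km km1) comp_lfun0r; have [k1m | km2] := eqVneq (k - 1) m.
  have [b0 b0E] : {b0 : 'Hom(cobj C (k - 1), cobj D (k - 1))
      | two_deg a b (k - 1) = b0 & (cycles C (k - 1) <= lker b0)%VS}.
    exists (two_deg a b (k - 1)) => //.
    by rewrite k1m two_deg_top.
  rewrite b0E => /subvP Zb0; apply/esym/lfunP=> x; rewrite comp_lfunE lfunE.
  by apply/eqP; rewrite -memv_ker Zb0 // cyclesE cdd.
rewrite two_deg_out ?comp_lfun0l //; lia.
Qed.

Definition two_deg_map : chain_map C D := ChainMap two_deg_comm.

End TwoDegrees.

(** * Fullness: lifting a morphism of persistent homology *)

Section Full.
Variables (F : fieldType) (X Y : fcomplex F) (m : int).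
Variable g : pmor (Pn (m - 1) X) (Pn (m - 1) Y).

Local Notation x_ p := (fc X p).
Local Notation y_ p := (fc Y p).
Local Notation i_ := (fun p => cm (fincl X p)).
Local Notation j_ := (fun p => cm (fincl Y p)).

Let gp p : 'Hom(homology (x_ p) (m - 1), homology (y_ p) (m - 1)) := pm g p.

Let g_natural p z : z \in cycles (x_ p) (m - 1) ->
  gp (p + 1) (hclass _ _ (i_ p _ z)) = hmap (fincl Y p) _ (gp p (hclass _ _ z)).
Proof.
move=> Zz; rewrite -hmap_class //.
have /lfunP/(_ (hclass (x_ p) (m - 1) z)) := pm_comm g p.
by rewrite (comp_lfunE (parr _ _)) (comp_lfunE (pm g (p + 1))) => ->.
Qed.

(** The differential of the retracted chain vanishes after inclusion into [x_ (p + 1)], and the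
    inclusion is injective in degree [k - 1]. *)
Lemma strict_retr_cycle p k z : z \in cycles (x_ (p + 1)) k ->
  strict_retr (i_ p k) (cd (x_ (p + 1)) k) z \in cycles (x_ p) k.
Proof.
rewrite !cyclesE => /eqP dz; apply/eqP/(lker0_eq0 (fincl_inj X p _)).
by rewrite -cm_cd strict_retr_ker.
Qed.

Definition bot_spec p (f : 'Hom(cobj (x_ p) (m - 1), cobj (y_ p) (m - 1))) :=
  (cd (y_ p) (m - 1) \o f)%VF = 0 /\
  {in cycles (x_ p) (m - 1), forall z, hclass _ _ (f z) = gp p (hclass _ _ z)}.

Definition bot_map p := (hrepr (y_ p) (m - 1) \o gp p \o hclass (x_ p) (m - 1))%VF.

Lemma bot_mapE p x : bot_map p x = hrepr _ _ (gp p (hclass _ _ x)).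
Proof. by rewrite /bot_map (comp_lfunE _ (hclass _ _)) (comp_lfunE (hrepr _ _)). Qed.

Lemma d_bot_map p x : cd (y_ p) (m - 1) (bot_map p x) = 0.
Proof. by rewrite bot_mapE; apply/eqP; rewrite -cyclesE hrepr_cycle. Qed.

Lemma bot_map_spec p : bot_spec (bot_map p).
Proof.
split=> [|z _]; last by rewrite bot_mapE hreprK.
by apply/lfunP=> x; rewrite (comp_lfunE (cd _ _)) d_bot_map lfunE.
Qed.

(** On a cycle [z] the retraction [u] is a cycle, and naturality of [g] gives [j (f u)] and
    [bot_map (i u)] the same class, so the correction does not change the class of the value at
    [z]. *)
Lemma bot_ext_spec p (f : 'Hom(cobj (x_ p) (m - 1), cobj (y_ p) (m - 1))) :
  bot_spec f ->
  bot_spec (ext_along (i_ p (m - 1)) (cd (x_ (p + 1)) (m - 1))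
              (j_ p (m - 1) \o f)%VF (bot_map (p + 1))).
Proof.
move=> [df fg]; split=> [|z Zz].
  apply/lfunP=> x; rewrite comp_lfunE ext_alongE linearD linearB /= !d_bot_map.
  rewrite comp_lfunE cm_cd -(comp_lfunE (cd _ _) f) df lfunE linear0 !subr0 addr0.
  by rewrite lfunE.
rewrite ext_alongE; set u := strict_retr _ _ _.
have Zu := strict_retr_cycle Zz : u \in _; have Ziu := cm_cycle (fincl X p) Zu.
have Zfu : f u \in cycles (y_ p) (m - 1).
  by rewrite cyclesE -(comp_lfunE (cd _ _)) df lfunE.
rewrite (linearD (hclass _ _)) /= (linearB (hclass _ _)) /= !bot_mapE !hreprK.
by rewrite g_natural // (comp_lfunE _ f) -hmap_class // fg // subrr addr0.
Qed.

(** Vanishing on cycles yields the chain map identity in degree [m + 1], where the lift is zero. *)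
Definition top_spec p (f : 'Hom(cobj (x_ p) (m - 1), cobj (y_ p) (m - 1)))
    (f' : 'Hom(cobj (x_ p) m, cobj (y_ p) m)) :=
  (cd (y_ p) m \o f' = f \o cd (x_ p) m)%VF /\ (cycles (x_ p) m <= lker f')%VS.

Definition top_map p (f : 'Hom(cobj (x_ p) (m - 1), cobj (y_ p) (m - 1))) :=
  ((cd (y_ p) m)^-1 \o f \o cd (x_ p) m)%VF.

(** Since [f] induces [gp p] on homology, it sends boundaries to boundaries, so the pseudo-inverse
    of [cd (y_ p) m] returns a true preimage of [f (d x)]. *)
Lemma top_map_spec p f : bot_spec f -> top_spec f (@top_map p f).
Proof.
move=> [df fg]; split; last first.
  apply/subvP=> z; rewrite cyclesE memv_ker !comp_lfunE => /eqP->.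
  by rewrite !linear0.
apply/lfunP=> x; rewrite !comp_lfunE limg_lfunVK // -boundariesE.
have Bdx : cd (x_ p) m x \in boundaries (x_ p) (m - 1).
  by rewrite boundariesE memv_img ?memvf.
have Zdx := subvP (boundaries_sub _ _) _ Bdx.
apply: hclass_eq0; first by rewrite cyclesE -(comp_lfunE (cd _ _)) df lfunE.
by rewrite fg // hclass_boundary // linear0.
Qed.

(** The terms [j (f' u)] and [top_map fS (i u)] have the same differential, so the correction is a
    cycle and the differential of [top_map fS] is kept. On cycles every term vanishes. *)
Lemma top_ext_spec p f f' (fS : 'Hom(cobj (x_ (p + 1)) (m - 1), cobj (y_ (p + 1)) (m - 1))) :
  bot_spec fS -> (j_ p (m - 1) \o f = fS \o i_ p (m - 1))%VF -> @top_spec p f f' ->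
  top_spec fS (ext_along (i_ p m) (cd (x_ (p + 1)) m) (j_ p m \o f')%VF (top_map fS)).
Proof.
move=> /top_map_spec[dt tZ] jf [df' f'Z].
have dtE x : cd _ m (top_map fS x) = fS (cd _ _ x).
  by rewrite -(comp_lfunE _ (top_map fS)) dt (comp_lfunE fS).
split.
  apply/lfunP=> x; rewrite 2!comp_lfunE ext_alongE linearD linearB /= !dtE.
  set u := strict_retr _ _ _; rewrite comp_lfunE !cm_cd -(comp_lfunE _ f') df'.
  rewrite comp_lfunE -(comp_lfunE _ f) jf -[fS (cm _ _ _)](comp_lfunE fS).
  by rewrite subrr addr0.
apply/subvP=> z Zz; rewrite memv_ker ext_alongE; set u := strict_retr _ _ _.
have Zu := strict_retr_cycle Zz : u \in _; have Ziu := cm_cycle (fincl X p) Zu.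
have t0 w : w \in cycles (x_ (p + 1)) m -> top_map fS w = 0.
  by move=> /(subvP tZ); rewrite memv_ker => /eqP.
rewrite !t0 // comp_lfunE; move/(subvP f'Z): Zu; rewrite memv_ker => /eqP->.
by rewrite linear0 subr0 addr0.
Qed.

Lemma exists_Pn_mor_lift : exists f : fmor X Y, forall p, Pn_mor (m - 1) f p = pm g p.
Proof.
have [p0 p0P] := fc_low X.
(* The sigma type carries the specification through the recursion, which every later extension step
   relies on. *)
have [f [_ fS]] := @exists_int_rec (fun p => {f | @bot_spec p f}) p0
  (fun p => exist _ _ (bot_map_spec p))
  (fun p f => exist _ _ (bot_ext_spec (svalP f))).
have f_nat p : (j_ p (m - 1) \o sval (f p) = sval (f (p + 1)) \o i_ p (m - 1))%VF.
  (* Below [p0] the source is zero, so both sides agree although the recursion gives no information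
     there. *)
  have [lt_p | le_p] := ltP p p0; first by apply/dim0_hom_eq/p0P/ltW.
  rewrite fS //=; apply/lfunP=> x.
  by rewrite [RHS]comp_lfunE ext_along_ext ?fincl_inj.
have [f' [_ f'S]] := @exists_int_rec (fun p => {f' | @top_spec p (sval (f p)) f'}) p0
  (fun p => exist _ _ (top_map_spec (svalP (f p))))
  (fun p f' => exist _ _ (top_ext_spec (svalP (f (p + 1))) (f_nat p) (svalP f'))).
have f'_nat p : (j_ p m \o sval (f' p) = sval (f' (p + 1)) \o i_ p m)%VF.
  have [lt_p | le_p] := ltP p p0; first by apply/dim0_hom_eq/p0P/ltW.
  rewrite f'S //=; apply/lfunP=> x.
  by rewrite [RHS]comp_lfunE ext_along_ext ?fincl_inj.
pose h p := two_deg_map (svalP (f p)).1 (svalP (f' p)).1 (svalP (f' p)).2.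
have h_nat p k : (j_ p k \o cm (h p) k = cm (h (p + 1)) k \o i_ p k)%VF.
  exact: two_deg_natural.
exists (FMor h_nat) => p; apply/lfunP=> x; have [z Zz ->] := hclass_surj x.
rewrite [LHS](hmap_class (h p)) // [cm _ _]two_deg_bot.
exact: (svalP (f p)).2.
Qed.

End Full.

(** Writing [n] as [n + 1 - 1] lets the differential out of degree [n + 1] land in the working
    degree without a cast. *)
Lemma Phi_is_full (F : fieldType) (n : int) : Phi_full F n.
Proof. by rewrite -(addrK 1 n) => X Y g; apply: exists_Pn_mor_lift. Qed.

(** * Two-term complexes and the maps between them *)

Section TwoTerm.
Variables (F : fieldType) (m : int).

Section TwoTermComplex.
Variables (E : vectType F) (K : {vspace E}).

(* The complex [K -> E] in degrees [m] and [m - 1]; taking all its terms to be subspaces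
   of [E] lets the case analysis on the degree bear on values rather than on types. *)
Definition two_term_space (k : int) : {vspace E} :=
  if k == m then K else if k == m - 1 then fullv else 0%VS.

Definition two_term_d k :
  'Hom(subvs_of (two_term_space k), subvs_of (two_term_space (k - 1))) :=
  if k == m then (linfun (vsproj (two_term_space (k - 1))) \o
                  linfun (@vsval _ _ (two_term_space k)))%VF else 0.

Lemma two_term_d_eq0 k x : k != m -> two_term_d k x = 0.
Proof. by move=> km; rewrite /two_term_d (negbTE km) lfunE. Qed.

Lemma two_term_space_bot k : k = m -> two_term_space (k - 1) = fullv.
Proof. by move=> ->; rewrite /two_term_space eqxx; case: eqP => //; lia. Qed.

Lemma two_term_dE k x : k = m -> vsval (two_term_d k x) = vsval x.
Proof.
move=> km; rewrite /two_term_d ifT; last exact/eqP.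
rewrite comp_lfunE !lfunE /= vsprojK //.
by rewrite two_term_space_bot // memvf.
Qed.

Lemma two_term_space_out k : k != m -> k != m - 1 -> two_term_space k = 0%VS.
Proof. by rewrite /two_term_space => /negbTE-> /negbTE->. Qed.

Lemma two_term_d_comp k : (two_term_d (k - 1) \o two_term_d k)%VF = 0.
Proof.
apply/lfunP=> x; rewrite comp_lfunE lfunE /=.
have [km | km] := eqVneq k m; last by rewrite (two_term_d_eq0 x km) linear0.
by rewrite two_term_d_eq0 //; lia.
Qed.

Lemma two_term_d_fin : exists s : seq int, forall k, k \notin s -> lfun_iso (two_term_d k).
Proof.
(* Degree [m + 1] is listed because its differential lands in degree [m]; outside the list both
   source and target are zero. *)
exists [:: m + 1; m; m - 1] => k; rewrite !inE !negb_or => /and3P[k1 k2 k3].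
have sub0 l (x : subvs_of (two_term_space l)) : l != m -> l != m - 1 -> x = 0.
  move=> lm lm1; apply/subvs_inj/eqP; rewrite linear0 -memv0 -(two_term_space_out lm lm1).
  exact: subvsP.
apply/lfun_isoP; split=> [u _ | v]; first exact: sub0.
by exists 0; rewrite linear0; apply: sub0; lia.
Qed.

Definition two_term_complex : complex F := Complex two_term_d_comp two_term_d_fin.

Lemma two_term_cycles : cycles two_term_complex (m - 1) = fullv.
Proof.
apply/eqP; rewrite eqEsubv subvf; apply/subvP=> x _.
by rewrite cyclesE /= two_term_d_eq0 //; lia.
Qed.

Lemma two_term_top_mem v : (v \in two_term_space m) = (v \in K).
Proof. by rewrite /two_term_space eqxx. Qed.

(** Together with [two_term_cycles], this identifies the homology in degree [m - 1] with the
    quotient of [E] by [K]. *)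
Lemma two_term_boundary (x : cobj two_term_complex (m - 1)) :
  (x \in boundaries two_term_complex (m - 1)) = (vsval x \in K).
Proof.
rewrite boundariesE; apply/memv_imgP/idP => [[y _ ->] /= | Kx].
  by rewrite two_term_dE // -(two_term_top_mem (vsval y)) subvsP.
exists (vsproj (two_term_space m) (vsval x)); rewrite ?memvf //=.
by apply/subvs_inj; rewrite two_term_dE // vsprojK // two_term_top_mem.
Qed.

End TwoTermComplex.

Section TwoTermMap.
Variables (E E' : vectType F) (K : {vspace E}) (K' : {vspace E'}) (f : 'Hom(E, E')).
Hypothesis fK : (f @: K <= K')%VS.

Definition two_term_cm k :
  'Hom(subvs_of (two_term_space K k), subvs_of (two_term_space K' k)) :=
  (linfun (vsproj (two_term_space K' k)) \o f \o linfun (@vsval _ _ (two_term_space K k)))%VF.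

Lemma two_term_space_sub k x : x \in two_term_space K k -> f x \in two_term_space K' k.
Proof.
rewrite /two_term_space; case: ifP => _; first by move=> Kx; rewrite (subvP fK) ?memv_img.
by case: ifP => _; rewrite ?memvf // !memv0 => /eqP->; rewrite linear0.
Qed.

Lemma two_term_cmE k x : vsval (two_term_cm k x) = f (vsval x).
Proof. by rewrite /two_term_cm !comp_lfunE !lfunE /= vsprojK // two_term_space_sub ?subvsP. Qed.

Lemma two_term_cm_comm k :
  (two_term_d K' k \o two_term_cm k = two_term_cm (k - 1) \o two_term_d K k)%VF.
Proof.
apply/lfunP=> x; rewrite (comp_lfunE (two_term_d _ _)) (comp_lfunE (two_term_cm _)).
have [km | km] := eqVneq k m; last by rewrite !two_term_d_eq0 // linear0.
by apply/subvs_inj; rewrite two_term_dE // !two_term_cmE two_term_dE.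
Qed.

Definition two_term_map : chain_map (two_term_complex K) (two_term_complex K') :=
  @ChainMap _ (two_term_complex K) (two_term_complex K') _ two_term_cm_comm.

End TwoTermMap.

End TwoTerm.

Lemma pvs_iso_pointwise (F : fieldType) (W W' : pvs F) (a : pmor W W') :
  (forall p, lfun_iso (pm a p)) -> pvs_iso W W'.
Proof.
move=> a_iso.
have aK p : cancel (pm a p) (pm a p)^-1%VF.
  by apply: lker0_lfunK; have [-> _] := a_iso p.
have aVK p : cancel (pm a p)^-1%VF (pm a p).
  by move=> y; rewrite limg_lfunVK //; have [_ ->] := a_iso p; rewrite memvf.
have comm p : (parr W p \o (pm a p)^-1 = (pm a (p + 1))^-1 \o parr W' p)%VF.
  apply/lfunP=> y; rewrite !comp_lfunE -{2}(aVK p y) -(comp_lfunE (parr W' p)).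
  by rewrite pm_comm comp_lfunE aK.
by exists a, (PMor comm) => p; split; apply/lfunP=> x; rewrite comp_lfunE id_lfunE /= ?aK ?aVK.
Qed.

(** * Essential surjectivity: realizing a tempered diagram bounded below *)

Section EssSurj.
Variables (F : fieldType) (m : int) (W : pvs F).

Record cover p := Cover {
  cov : vectType F;
  cov_map : 'Hom(cov, pobj W p);
  cov_surj : limg cov_map = fullv }.

(** The last clause makes the filtration stationary wherever [W] is, as [fc_fin] demands. *)
Definition cover_incl p (x : cover p) (y : cover (p + 1)) (i : 'Hom(cov x, cov y)) :=
  [/\ lker i = 0%VS, (cov_map y \o i = parr W p \o cov_map x)%VF &
      lfun_iso (parr W p) -> limg i = fullv].

Lemma triv_cover_surj p : limg (\1 : 'End(pobj W p))%VF = fullv.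
Proof. by rewrite lim1g. Qed.

Lemma next_cover p (x : cover p) :
  {y : cover (p + 1) & {i : 'Hom(cov x, cov y) | cover_incl i}}.
Proof.
have surj v : exists u, v = cov_map x u.
  have: v \in limg (cov_map x) by rewrite cov_surj memvf.
  by case/memv_imgP=> u _; exists u.
(* A boolean test is used because the goal lives in [Type], while [lfun_iso] is a proposition. *)
have [/andP[/eqP kW /eqP rW] | notiso] :=
    boolP ((lker (parr W p) == 0%VS) && (limg (parr W p) == fullv)).
  have s : limg (parr W p \o cov_map x)%VF = fullv by rewrite limg_comp cov_surj.
  exists (Cover s), \1%VF; split=> [||_] /=; rewrite ?lim1g ?comp_lfun1r //.
  by apply/eqP/lker0P=> u v; rewrite !id_lfunE.
(* Adjoining [pobj W (p + 1)] as a summand forces surjectivity, while [cov x] embeds as the first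
   factor. *)
pose E : vectType F := (cov x * pobj W (p + 1))%type.
pose e : 'Hom(E, pobj W (p + 1)) :=
  ((parr W p \o cov_map x \o linfun fst)%VF + linfun snd).
have eE z : e z = parr W p (cov_map x z.1) + z.2.
  by rewrite /e add_lfunE !comp_lfunE !lfunE.
have s : limg e = fullv.
  apply/eqP; rewrite eqEsubv subvf; apply/subvP=> v _; apply/memv_imgP.
  by exists (0, v); rewrite ?memvf // eE /= !linear0 add0r.
have i_lin : linear (fun u : cov x => (u, 0) : E).
  by move=> a u v; congr pair; rewrite /= scaler0 addr0.
pose iL := GRing.isLinear.Build F (cov x) E _ (fun u : cov x => (u, 0) : E) i_lin.
pose iF : {linear cov x -> E} := HB.pack (fun u : cov x => (u, 0) : E) iL.
have iE u : linfun iF u = (u, 0) by rewrite lfunE.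
exists (Cover s), (linfun iF); split=> /=.
- by apply/eqP/lker0P=> u v; rewrite !iE => -[].
- by apply/lfunP=> u; rewrite !comp_lfunE iE eE addr0.
- by move=> [kW rW]; rewrite kW rW !eqxx in notiso.
Qed.

Hypotheses (W_temp : tempered W) (W_low : bounded_below W).

Lemma exists_Pn_iso : exists X : fcomplex F, pvs_iso (Pn (m - 1) X) W.
Proof.
have [p0 p0P] := W_low.
have [c [c_low c_step]] := exists_int_rec p0
  (fun p => Cover (triv_cover_surj p)) (fun p x => projT1 (next_cover x)).
have c_incl p : {i : 'Hom(cov (c p), cov (c (p + 1))) | cover_incl i}.
  have [le_p | le_p] := leP p0 p.
    by rewrite (c_step p le_p); exact: projT2 (next_cover (c p)).
  (* Here [p + 1 <= p0], so both covers are identities; the arrow of [W] itself serves as inclusion,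
     being injective on a zero space. *)
  rewrite !c_low; try lia.
  exists (parr W p); split=> /=.
  - by apply/eqP/lker0P=> u v _; rewrite (dim0_eq0 u) ?(dim0_eq0 v) // p0P; lia.
  - by rewrite comp_lfun1l comp_lfun1r.
  - by case.
pose K p := lker (cov_map (c p)).
pose i p := sval (c_incl p).
have ki p : lker (i p) = 0%VS by have [] := svalP (c_incl p).
have ei p u : cov_map (c (p + 1)) (i p u) = parr W p (cov_map (c p) u).
  by rewrite -!comp_lfunE; have [_ ->] := svalP (c_incl p).
have iK p : (i p @: K p <= K (p + 1)%R)%VS.
  apply/subvP=> _ /memv_imgP[u Ku ->]; rewrite memv_ker ei.
  by move: Ku; rewrite memv_ker => /eqP->; rewrite linear0.
pose incl p := two_term_map m (iK p).
have incl_inj p k : lker (cm (incl p) k) = 0%VS.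
  have i_inj : injective (i p) by apply/lker0P/eqP/ki.
  by apply/eqP/lker0P=> u v /(congr1 vsval); rewrite !(two_term_cmE (iK p)) => /i_inj/subvs_inj.
have low : exists p0 : int, forall p : int, p <= p0 -> forall k : int,
    \dim (fullv : {vspace cobj (two_term_complex m (K p)) k}) = 0%N.
  exists p0 => p le_p k; apply/eqP; rewrite dimv_eq0 -subv0; apply/subvP=> u _.
  rewrite memv0; apply/eqP/subvs_inj; rewrite linear0; apply: dim0_eq0.
  by rewrite c_low //= p0P.
have fin : exists s : seq int, forall p : int, p \notin s -> forall k : int,
    limg (cm (incl p) k) = fullv.
  have [s sP] := W_temp; exists s => p /sP p_iso k.
  apply/eqP; rewrite eqEsubv subvf; apply/subvP=> v _.
  have [_ _ /(_ p_iso) ri] := svalP (c_incl p).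
  have : vsval v \in limg (i p) by rewrite ri memvf.
  (* In degree [m], [i p u] in [K (p + 1)] forces [u] into [K p], because the arrow of [W] is
     injective. *)
  case/memv_imgP=> u _ vu; have Su : u \in two_term_space m (K p) k.
    have := subvsP v; rewrite vu /two_term_space; case: ifP => _.
      rewrite !memv_ker ei => /eqP/(lker0_eq0 p_iso.1)->; exact: eqxx.
    case: ifP => _; first by rewrite !memvf.
    by rewrite !memv0 => /eqP/(lker0_eq0 (ki p))->.
  apply/memv_imgP; exists (vsproj _ u); rewrite ?memvf //.
  by apply/subvs_inj; rewrite (two_term_cmE (iK p)) vsprojK.
pose X := FComplex incl_inj low fin.
pose ev p : 'Hom(cobj (fc X p) (m - 1), pobj W p) :=
  (cov_map (c p) \o linfun (@vsval _ _ (two_term_space m (K p) (m - 1))))%VF.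
have evE p x : ev p x = cov_map (c p) (vsval x) by rewrite /ev comp_lfunE lfunE.
(* Boundaries are exactly the kernel of the evaluation [ev], so it descends to homology and is
   injective there. *)
have evB p x : (x \in boundaries (fc X p) (m - 1)) = (ev p x == 0).
  by rewrite two_term_boundary memv_ker evE.
have allZ p x : x \in cycles (fc X p) (m - 1) by rewrite two_term_cycles memvf.
pose a p : 'Hom(homology (fc X p) (m - 1), pobj W p) := (ev p \o hrepr _ _)%VF.
have a_class p z : a p (hclass _ _ z) = ev p z.
  rewrite /a (comp_lfunE (ev p)); apply/eqP.
  by rewrite eq_sym -subr_eq0 -linearB -evB hrepr_class.
have a_comm p : (parr W p \o a p = a (p + 1) \o parr (Pn (m - 1) X) p)%VF.
  apply/lfunP=> x; have [z Zz ->] := hclass_surj x.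
  rewrite (comp_lfunE (parr W p)) (comp_lfunE (a (p + 1))).
  by rewrite [parr (Pn _ _) _ _](hmap_class (incl p)) // !a_class !evE (two_term_cmE (iK p)) ei.
exists X; apply: (@pvs_iso_pointwise _ (Pn (m - 1) X) W (@PMor _ (Pn (m - 1) X) W a a_comm)) => p.
apply/lfun_isoP; split=> [x | v] /=.
  have [z Zz ->] := hclass_surj x; rewrite a_class => /eqP.
  by rewrite -evB => /hclass_boundary.
have : v \in limg (cov_map (c p)) by rewrite cov_surj memvf.
case/memv_imgP=> u _ ->.
exists (hclass (fc X p) (m - 1) (vsproj (two_term_space m (K p) (m - 1)) u)).
by rewrite a_class evE vsprojK // two_term_space_bot // memvf.
Qed.

End EssSurj.

Lemma Phi_is_ess_surj (F : fieldType) (n : int) : Phi_ess_surj F n.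
Proof. by rewrite -(addrK 1 n) => W; apply: exists_Pn_iso. Qed.

Theorem theorem3p3 (F : fieldType) (n : int) :
  Phi_functor F n /\ Phi_equivalence F n.
Proof.
split; first exact: Phi_is_functor.
(* Faithfulness holds by the very definition of [coim_eq]. *)
by split; last split; [| exact: Phi_is_full | exact: Phi_is_ess_surj].
Qed.
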